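(* (Cell Decomposition Theorem) Let $\mathcal R$ be a unital ring, let $M$ be a right $\mathcal R$-module with $Th(M)=Th(M)^{\aleph_0}$, and let $n\geq 1$. Then there is a bijection between the set $\mathrm{Def}(M^n)$ of all definable subsets of $M^n$ and the set $\mathcal T$ of towers of cells in $M^n$.
   Context: **pp-sets.** A right $\mathcal R$-module $M$ is viewed as a first order structure in the language $\langle 0,+,-,m_r: r\in\mathcal R\rangle$, where $m_r$ is right multiplication by $r$; ''definable'' means definable with parameters from $M$. A pp-formula is a formula equivalent to one of the form $\exists y_1\dots\exists y_m\bigwedge_{i=1}^t\left(\sum_j x_jr_{ij}+\sum_k y_ks_{ik}+c_i=0\right)$ with $r_{ij},s_{ik}\in\mathcal R$ and parameters $c_i\in M$. A pp-set is a subset of $M^n$ defined by a pp-formula; it is empty or a coset of a subgroup of $M^n$ defined by a parameter-free pp-formula (a pp-definable subgroup). $\mathcal L$ is the set of pp-subsets of $M^n$ ($n$ fixed). **The condition $Th(M)=Th(M)^{\aleph_0}$** means $M\equiv M^{(\aleph_0)}$ (the direct sum of countably many copies of $M$); equivalently, for every $m\ge1$ and all pp-definable subgroups $A,B$ of $M^m$, the index $[A:A\cap B]$ is $1$ or infinite. **Antichains and cells.** $\mathcal A$ is the set of finite antichains (with respect to inclusion) in $\mathcal L\setminus\{\emptyset\}$. For $\alpha,\beta\in\mathcal A$ write $\beta\prec\alpha$ if for each $B\in\beta$ there is $A\in\alpha$ with $B\subsetneq A$. A cell is a set $C=\bigcup\alpha\setminus\bigcup\beta$ with $\alpha,\beta\in\mathcal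 A$, $\beta\prec\alpha$; under the condition $Th(M)=Th(M)^{\aleph_0}$ the antichains $\alpha,\beta$ are uniquely determined by $C$ and are denoted $P(C):=\alpha$, $N(C):=\beta$. **Towers.** A family $\mathcal F=\{C_j\}_{j=1}^l$ of pairwise disjoint cells in $M^n$ is a tower of cells if there is a permutation $\sigma$ of $\{1,\dots,l\}$ such that $P(C_{\sigma(j+1)})\prec N(C_{\sigma(j)})$ for $1\le j\le l-1$. $\mathcal T$ is the set of all finite towers of cells.
   Formalization: Cells in a tower are required to be nonempty and the empty tower is allowed (for the empty set); if the empty set counted as a cell, M = 0 would have at least three towers but only two definable sets. The bijection is given by taking unions. *)

(* Defs.v *)
From HB Require Import structures.
From mathcomp Require Import all_boot all_order all_algebra all_fingroup.
From mathcomp Require Import boolp classical_sets functions cardinality.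

Set Implicit Arguments.
Unset Strict Implicit.
Unset Printing Implicit Defensive.

Import GRing.Theory.

Local Open Scope classical_set_scope.
Local Open Scope ring_scope.

(* A right R-module is a left module over the converse ring R^c:
   (x . r) . s = s *: (r *: x) = (s * r in R^c) *: x = x . (r * s). *)
Definition rscale (R : pzRingType) (M : lmodType R^c) (x : M) (r : R) : M :=
  (r : R^c) *: x.

(* [term R k] and [formula R k] have their free variables in 'I_k; in [Ex f]
   the bound variable is [ord0], and variable i of the context becomes
   [lift ord0 i]. The connectives Eq, Not, And, Ex generate classically all
   first-order formulas. *)
Inductive term (R : Type) (k : nat) : Type :=
| Var of 'I_k
| Zero
| Add of term R k & term R k
| Opp of term R k
| Act of term R k & R.

Inductive formula (R : Type) : nat -> Type :=
| Eq k : term R k -> term R k -> formula R k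
| Not k : formula R k -> formula R k
| And k : formula R k -> formula R k -> formula R k
| Ex k : formula R k.+1 -> formula R k.

Definition env_cons (T : Type) k (a : T) (e : 'I_k -> T) : 'I_k.+1 -> T :=
  fun i => if unlift ord0 i is Some j then e j else a.

Definition env_cat (T : Type) n p (x : 'I_n -> T) (c : 'I_p -> T) :
    'I_(n + p) -> T :=
  fun i => match fintype.split i with inl j => x j | inr j => c j end.

Section Semantics.
Variables (R : pzRingType) (M : lmodType R^c).

Fixpoint eval k (e : 'I_k -> M) (t : term R k) : M :=
  match t with
  | Var i => e i
  | Zero => 0
  | Add u v => eval e u + eval e v
  | Opp u => - eval e u
  | Act u r => rscale (eval e u) r
  end.

Fixpoint holds k (f : formula R k) : ('I_k -> M) -> Prop :=
  match f in formula _ k return ('I_k -> M) -> Prop with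
  | Eq _ t u => fun e => eval e t = eval e u
  | Not _ g => fun e => ~ holds g e
  | And _ g h => fun e => holds g e /\ holds h e
  | Ex _ g => fun e => exists a : M, holds g (env_cons a e)
  end.

(* [c] lists the parameters. *)
Definition definable n (D : set ('I_n -> M)) : Prop :=
  exists (p : nat) (f : formula R (n + p)) (c : 'I_p -> M),
    D = [set x | holds f (env_cat x c)].

(* Being a pp-formula is invariant under equivalence of formulas, so the pp-sets
   are exactly the solution sets of existentially quantified linear systems. *)
Definition pp_set n (A : set ('I_n -> M)) : Prop :=
  exists (m t : nat) (r : 'I_n -> 'I_t -> R) (s : 'I_m -> 'I_t -> R)
         (c : 'I_t -> M),
    A = [set x | exists y : 'I_m -> M, forall i : 'I_t,
           \sum_(j < n) rscale (x j) (r j i) + \sum_(k < m) rscale (y k) (s k i)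
             + c i = 0].

End Semantics.

Definition elem_equiv (R : pzRingType) (M N : lmodType R^c) : Prop :=
  forall f : formula R 0,
    holds f (fun _ : 'I_0 => 0 : M) <-> holds f (fun _ : 'I_0 => 0 : N).

(* The direct sum of countably many copies of M, as the submodule of finitely
   supported sequences of the product module nat -> M. *)
Section Copower.
Variables (R : pzRingType) (M : lmodType R).

Definition fin_supp : {pred nat -> M} :=
  fun x => `[< finite_set [set i | x i != 0] >].

Lemma fin_supp_submod : submod_closed fin_supp.
Proof.
split=> [|a x y]; rewrite !unfold_in /fin_supp.
  apply/asboolP; rewrite (_ : [set _ | _] = set0) //.
  by apply/seteqP; split=> i //=; rewrite eqxx.
move=> /asboolP fx /asboolP fy; apply/asboolP.
apply: (@sub_finite_set _ _
  ([set i | x i != 0] `|` [set i | y i != 0])); last by rewrite finite_setU.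
move=> i /= nz; have [x0|] := eqVneq (x i) 0; last by left.
right; apply: contra_neq nz => y0; rewrite fctE.
by rewrite (_ : (a *: x) i = a *: x i) // x0 y0 scaler0 addr0.
Qed.

HB.instance Definition _ :=
  GRing.isSubmodClosed.Build R (nat -> M) fin_supp fin_supp_submod.

Record copower := Copower { copower_val : nat -> M; _ : copower_val \in fin_supp }.

HB.instance Definition _ := [isSub for copower_val].
HB.instance Definition _ := [Choice of copower by <:].
HB.instance Definition _ := [SubChoice_isSubLmodule of copower by <:].

End Copower.

Section Cells.
Variables (R : pzRingType) (M : lmodType R^c) (n : nat).
Implicit Types (C : set ('I_n -> M)) (a b : set (set ('I_n -> M))).

Definition union a : set ('I_n -> M) := \bigcup_(A in a) A.

(* The empty antichain is allowed. *)
Definition antichain a : Prop :=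
  [/\ finite_set a,
      forall A, a A -> pp_set A /\ A !=set0 &
      forall A B, a A -> a B -> A `<=` B -> A = B].

Definition prec b a : Prop :=
  forall B, b B -> exists2 A, a A & B `<` A.

Definition presents C (ab : set (set ('I_n -> M)) * set (set ('I_n -> M))) :=
  [/\ antichain ab.1, antichain ab.2, prec ab.2 ab.1 &
      C = union ab.1 `\` union ab.2].

Definition cell C : Prop := exists ab, presents C ab.

(* The presentation of a cell is chosen; it is unique when M is elementarily
   equivalent to its countable copower. *)
Definition cell_pres C := xget (set0, set0) (presents C).
Definition cell_P C := (cell_pres C).1.
Definition cell_N C := (cell_pres C).2.

(* A tower is an unordered family; since its members are nonempty and pairwise
   disjoint it can be encoded as the set of its members. The empty set is
   literally a cell (with both antichains empty), but it must not occur in a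
   tower: it could be appended to any tower without changing its union. The
   empty family (l = 0) is a tower, with empty union. *)
Definition tower (F : set (set ('I_n -> M))) : Prop :=
  exists (l : nat) (C : 'I_l -> set ('I_n -> M)),
    [/\ F = range C,
        forall j, cell (C j) /\ C j !=set0,
        trivIset setT C &
        exists s : {perm 'I_l}, forall i j : 'I_l, j = i.+1 :> nat ->
          prec (cell_P (C (s j))) (cell_N (C (s i)))].

End Cells.

(* Main.v *)
(* By transfer it suffices to see in the copower that a nonempty pp-set A
   contained in a finite union of pp-sets B_i lies in one of them: otherwise
   elements a_i, b_i of A witnessing that A is not inside B_i can be spread over
   fresh coordinates to give a point of A outside every B_i.  So pp-sets are
   irreducible for the topology whose closed sets are finite unions of pp-sets.
   Irreducibility gives quantifier elimination down to Boolean combinations of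
   pp-sets.  The tower of a definable set D is its canonical decomposition as a
   constructible set: the closure F_1 of D, the closure F_2 of F_1 \ D, the
   closure F_3 of the part of D in F_2, and so on; the antichain of irreducible
   components of each F_i is determined by D. *)
Require Import Defs.
From mathcomp Require Import all_boot all_order all_algebra all_fingroup.
From mathcomp Require Import boolp classical_sets functions cardinality.

Set Implicit Arguments.
Unset Strict Implicit.
Unset Printing Implicit Defensive.

Import GRing.Theory.

Local Open Scope classical_set_scope.
Local Open Scope ring_scope.

(** * Affine functionals and pp-sets *)

(** Copairing: variables can range over arbitrary finite types, free variables and witnesses being
    kept apart without index arithmetic. *)
Definition sumf (T V W : Type) (x : V -> T) (y : W -> T) (z : V + W) : T :=
  match z with inl v => x v | inr w => y w end.

Section RightScale.
Variables (R : pzRingType) (M : lmodType R^c).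
Implicit Types (x y : M) (r s : R).

Lemma rscaleDl x y r : rscale (x + y) r = rscale x r + rscale y r.
Proof. exact: scalerDr. Qed.

Lemma rscaleDr x r s : rscale x (r + s) = rscale x r + rscale x s.
Proof. exact: scalerDl. Qed.

Lemma rscaleA x r s : rscale (rscale x r) s = rscale x (r * s).
Proof. exact: scalerA. Qed.

Lemma rscale0l r : rscale (0 : M) r = 0.
Proof. exact: scaler0. Qed.

Lemma rscale0r x : rscale x 0 = 0.
Proof. exact: scale0r. Qed.

Lemma rscale1 x : rscale x 1 = x.
Proof. exact: scale1r. Qed.

Lemma rscaleN1 x : rscale x (- 1) = - x.
Proof. exact: scaleN1r. Qed.

Lemma rscaleBl x y r : rscale (x - y) r = rscale x r - rscale y r.
Proof. exact: scalerBr. Qed.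

Lemma rscale_suml (I : finType) (x : I -> M) r :
  rscale (\sum_i x i) r = \sum_i rscale (x i) r.
Proof. exact: scaler_sumr. Qed.

End RightScale.

Section Affine.
Variables (R : pzRingType) (M : lmodType R^c).

(** A property of functions rather than a syntax of linear terms, so that substitution is plain
    composition. *)
Definition affine (V : finType) (u : (V -> M) -> M) : Prop :=
  exists (r : V -> R) (c : M), forall x, u x = \sum_v rscale (x v) (r v) + c.

Lemma affine_var (V : finType) (v : V) : affine (fun x => x v).
Proof.
exists (fun w => (w == v)%:R), 0 => x.
rewrite (bigD1 v) //= eqxx rscale1 big1 ?addr0 // => w /negbTE ->.
by rewrite rscale0r.
Qed.

Lemma affine_cst (V : finType) (c : M) : affine (fun _ : V -> M => c).
Proof.
by exists (fun=> 0), c => x; rewrite big1 ?add0r // => v _; rewrite rscale0r.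
Qed.

Lemma affineD (V : finType) (u w : (V -> M) -> M) :
  affine u -> affine w -> affine (fun x => u x + w x).
Proof.
move=> [r [c uE]] [s [d wE]]; exists (fun v => r v + s v), (c + d) => x.
under eq_bigr do rewrite rscaleDr.
by rewrite big_split uE wE addrACA.
Qed.

Lemma affine_rscale (V : finType) (u : (V -> M) -> M) (a : R) :
  affine u -> affine (fun x => rscale (u x) a).
Proof.
move=> [r [c uE]]; exists (fun v => r v * a), (rscale c a) => x.
rewrite uE rscaleDl rscale_suml.
by under eq_bigr do rewrite rscaleA.
Qed.

Lemma affineN (V : finType) (u : (V -> M) -> M) :
  affine u -> affine (fun x => - u x).
Proof.
move=> /(affine_rscale (- 1)); congr affine; apply: funext => x.
exact: rscaleN1.
Qed.

Lemma affine_sum (V I : finType) (u : I -> (V -> M) -> M) :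
  (forall i, affine (u i)) -> affine (fun x => \sum_i u i x).
Proof.
move=> au; elim: (index_enum I) => [|i s IHs].
  by under eq_fun do rewrite big_nil; exact: affine_cst.
by under eq_fun do rewrite big_cons; exact: affineD.
Qed.

Lemma affine_comp (V W : finType) (u : (V -> M) -> M)
    (g : (W -> M) -> V -> M) :
  affine u -> (forall v, affine (g^~ v)) -> affine (u \o g).
Proof.
move=> [r [c uE]] ag.
have -> : u \o g = fun x => \sum_v rscale (g x v) (r v) + c.
  by apply: funext => x; exact: uE.
apply: affineD; last exact: affine_cst.
by apply: affine_sum => v; apply: affine_rscale; exact: ag.
Qed.

Lemma affine_eval k (t : term R k) : affine (fun e : 'I_k -> M => eval e t).
Proof.
elim: t => [i||t IHt u IHu|t IHt|t IHt r] /=.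
- exact: affine_var.
- exact: affine_cst.
- exact: affineD.
- exact: affineN.
- exact: affine_rscale.
Qed.

End Affine.

Section PPSets.
Variables (R : pzRingType) (M : lmodType R^c).

(** Enumerating [W] and [I] gives a system indexed by ordinals; together with [pp_elim] this hides
    coefficients from most closure properties below. *)
Lemma pp_intro n (W I : finType) (u : I -> ('I_n + W -> M) -> M) :
  (forall i, affine (u i)) ->
  pp_set [set x | exists y : W -> M, forall i, u i (sumf x y) = 0].
Proof.
move=> au.
have /choice[rc rcE] i : exists rc : ('I_n + W -> R) * M,
    forall x, u i x = \sum_v rscale (x v) (rc.1 v) + rc.2.
  by have [r [c rcE]] := au i; exists (r, c).
exists #|W|, #|I|, (fun j i => (rc (enum_val i)).1 (inl j)),
  (fun k i => (rc (enum_val i)).1 (inr (enum_val k))),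
  (fun i => (rc (enum_val i)).2).
have uE x y i : u i (sumf x y) =
    \sum_j rscale (x j) ((rc i).1 (inl j)) +
    \sum_(k < #|W|) rscale (y (enum_val k)) ((rc i).1 (inr (enum_val k))) +
    (rc i).2.
  rewrite rcE big_sumType /=; congr (_ + _ + _).
  rewrite (reindex (@enum_val W W)) //=.
  by apply: onW_bij; exact: enum_val_bij.
apply/seteqP; split => x /= [y yP].
  by exists (y \o enum_val) => i; move: (yP (enum_val i)); rewrite uE.
exists (y \o enum_rank) => i; rewrite uE -[RHS](yP (enum_rank i)) enum_rankK.
by congr (_ + _ + _); apply: eq_bigr => k _; rewrite /= enum_valK.
Qed.

Lemma pp_elim n (A : set ('I_n -> M)) : pp_set A ->
  exists (W I : finType) (u : I -> ('I_n + W -> M) -> M),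
    (forall i, affine (u i)) /\
    A = [set x | exists y : W -> M, forall i, u i (sumf x y) = 0].
Proof.
move=> [m [t [r [s [c ->]]]]]; exists 'I_m, 'I_t.
exists (fun i z => \sum_j rscale (z (inl j)) (r j i) +
                   \sum_k rscale (z (inr k)) (s k i) + c i); split=> // i.
apply: affineD; last exact: affine_cst.
by apply: affineD; apply: affine_sum => j; apply: affine_rscale;
  exact: affine_var.
Qed.

Lemma pp_setI n (A B : set ('I_n -> M)) :
  pp_set A -> pp_set B -> pp_set (A `&` B).
Proof.
move=> /pp_elim[W1 [I1 [u1 [au1 ->]]]] /pp_elim[W2 [I2 [u2 [au2 ->]]]].
pose g1 (z : 'I_n + (W1 + W2) -> M) := sumf (z \o inl) (z \o inr \o inl).
pose g2 (z : 'I_n + (W1 + W2) -> M) := sumf (z \o inl) (z \o inr \o inr).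
pose u (i : I1 + I2) :=
  match i with inl j => u1 j \o g1 | inr j => u2 j \o g2 end.
rewrite (_ : _ `&` _ =
    [set x | exists y : W1 + W2 -> M, forall i, u i (sumf x y) = 0]).
  apply: pp_intro => -[i|i] /=; apply: affine_comp => //.
    by case=> v; exact: affine_var.
  by case=> v; exact: affine_var.
apply/seteqP; split=> x /=.
  by move=> [[y1 y1P] [y2 y2P]]; exists (sumf y1 y2) => -[i|i] /=;
    [exact: y1P | exact: y2P].
move=> [y yP]; split.
  by exists (y \o inl) => i; exact: (yP (inl i)).
by exists (y \o inr) => i; exact: (yP (inr i)).
Qed.

Lemma pp_affine_eq n (u : ('I_n -> M) -> M) :
  affine u -> pp_set [set x | u x = 0].
Proof.
move=> au; pose u' (i : unit) (z : 'I_n + void -> M) := u (z \o inl).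
rewrite (_ : [set _ | _] =
    [set x | exists y : void -> M, forall i, u' i (sumf x y) = 0]).
  apply: pp_intro => i; apply: (affine_comp (g := fun z => z \o inl)) => // v.
  exact: affine_var.
apply/seteqP; split=> x /=; first by exists (fun v : void => match v with end).
by case=> y /(_ tt).
Qed.

Lemma pp_setT n : pp_set (setT : set ('I_n -> M)).
Proof.
rewrite (_ : setT = [set _ | 0 = 0 :> M]); last by apply/seteqP; split.
exact: (@pp_affine_eq _ (fun=> 0)) (affine_cst _ _).
Qed.

Lemma pp_preimage n k (A : set ('I_k -> M)) (g : ('I_n -> M) -> 'I_k -> M) :
  (forall j, affine (g^~ j)) -> pp_set A -> pp_set (g @^-1` A).
Proof.
move=> ag /pp_elim[W [I [u [au ->]]]].
pose g' (z : 'I_n + W -> M) := sumf (g (z \o inl)) (z \o inr).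
apply: (pp_intro (u := fun i => u i \o g')) => i.
apply: affine_comp => // -[j|w] /=; last exact: affine_var.
apply: (@affine_comp _ _ _ _ (g^~ j) (fun z => z \o inl)) => // v.
exact: affine_var.
Qed.

Lemma pp_proj n (A : set ('I_n.+1 -> M)) :
  pp_set A -> pp_set [set x | exists a, A (env_cons a x)].
Proof.
move=> /pp_elim[W [I [u [au ->]]]].
(* The projected coordinate becomes one more witness, held in the [unit] summand. *)
pose g (z : 'I_n + (unit + W) -> M) :=
  sumf (env_cons (z (inr (inl tt))) (z \o inl)) (z \o inr \o inr).
rewrite (_ : [set _ | _] =
    [set x | exists y : unit + W -> M, forall i, (u i \o g) (sumf x y) = 0]).
  apply: (pp_intro (u := fun i => u i \o g)) => i.
  apply: affine_comp => // -[j|w]; last exact: affine_var.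
  by rewrite /g /= /env_cons; case: (unlift ord0 j) => [i'|]; exact: affine_var.
apply/seteqP; split=> x /=.
  by move=> [a [y yP]]; exists (sumf (fun=> a) y).
move=> [y yP]; exists (y (inl tt)), (y \o inr); exact: yP.
Qed.

(* The left-hand side is a heap operation: its closedness says that a pp-set is
   empty or a coset. *)
Lemma pp_heap n (A : set ('I_n -> M)) x y z :
  pp_set A -> A x -> A y -> A z -> A (fun j => x j - y j + z j).
Proof.
move=> /pp_elim[W [I [u [au ->]]]] [x' xP] [y' yP] [z' zP].
(* The witnesses combine like the points; an equation with constant c then reads -c + c - c + c =
   0. *)
exists (fun j => x' j - y' j + z' j) => i.
have [r [c uE]] := au i.
have -> : sumf (fun j => x j - y j + z j) (fun j => x' j - y' j + z' j) =
  (fun v => sumf x x' v - sumf y y' v + sumf z z' v).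
  by apply: funext; case.
move: (xP i) (yP i) (zP i); rewrite !uE.
under [X in _ -> _ -> _ -> X + _ = _]eq_bigr do rewrite rscaleDl rscaleBl.
rewrite big_split sumrB /= => /eqP; rewrite addr_eq0 => /eqP ->.
move=> /eqP; rewrite addr_eq0 => /eqP -> /eqP; rewrite addr_eq0 => /eqP ->.
by rewrite subrr add0r addNr.
Qed.

Lemma pp_bigcap n (I : finType) (A : I -> set ('I_n -> M)) (S : {set I}) :
  (forall i, pp_set (A i)) -> pp_set [set x | forall i, i \in S -> A i x].
Proof.
move=> Ap.
have pps (s : seq I) : pp_set [set x | forall i, i \in s -> A i x].
  elim: s => [|i s IHs].
    rewrite (_ : [set _ | _] = setT); first exact: pp_setT.
    by apply/seteqP; split.
  rewrite (_ : [set _ | _] = A i `&` [set x | forall i, i \in s -> A i x]).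
    exact: pp_setI.
  apply/seteqP; split=> x /=.
    move=> Ax; split=> [|j js]; apply: Ax; first exact: mem_head.
    by rewrite inE js orbT.
  by move=> [Aix Ax] j; rewrite inE => /orP[/eqP->|/Ax].
move: (pps (enum S)); congr pp_set; apply/seteqP.
by split=> x Ax i iS; apply: Ax; rewrite mem_enum in iS *.
Qed.

End PPSets.

(** * Renaming and uniform first-order definability *)

Lemma env_cons_eta (T : Type) k (e : 'I_k.+1 -> T) :
  env_cons (e ord0) (e \o lift ord0) = e.
Proof.
by apply: funext => i; rewrite /env_cons; case: unliftP => [j|] ->.
Qed.

(** This peels one variable off a block of quantifiers; the ascription is accepted because
    [m.+1 + k] computes to [(m + k).+1]. *)
Lemma env_cat_cons (T : Type) m k a (y : 'I_m -> T) (e : 'I_k -> T) :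
  env_cat (env_cons a y) e = env_cons a (env_cat y e) :> ('I_(m + k).+1 -> T).
Proof.
apply: funext => i; rewrite /env_cons /env_cat.
case: (unliftP ord0 i) => [j|] ->.
  case: (splitP j) => j' jE.
    case: splitP => i' /=; rewrite /bump /= add1n jE => i'E.
      case: unliftP => [i''|] iE; rewrite iE /= in i'E.
        by congr y; apply: val_inj; move: i'E; rewrite /bump /= add1n => -[].
      by [].
    move: (ltn_ord j'); move: i'E; rewrite addSn => -[->].
    by rewrite ltnNge leq_addr.
  case: splitP => i' /=; rewrite /bump /= add1n jE => i'E.
    by move: (ltn_ord i'); rewrite -i'E ltnS ltnNge leq_addr.
  by congr e; apply: val_inj; move: i'E; rewrite addSn => -[] /addnI.
case: splitP => i' /=; last by [].
by case: unliftP => // i'' ->.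
Qed.

Section Renaming.
Variable R : pzRingType.

Fixpoint term_ren k k' (h : 'I_k -> 'I_k') (t : term R k) : term R k' :=
  match t with
  | Var i => Var R (h i)
  | Zero => Zero R k'
  | Add u v => Add (term_ren h u) (term_ren h v)
  | Opp u => Opp (term_ren h u)
  | Act u r => Act (term_ren h u) r
  end.

Definition lift_ren k k' (h : 'I_k -> 'I_k') : 'I_k.+1 -> 'I_k'.+1 :=
  env_cons ord0 (lift ord0 \o h).

Fixpoint formula_ren k (f : formula R k) :
    forall k', ('I_k -> 'I_k') -> formula R k' :=
  match f with
  | Eq _ t u => fun k' h => Eq (term_ren h t) (term_ren h u)
  | Not _ g => fun k' h => Not (formula_ren g h)
  | And _ g g' => fun k' h => And (formula_ren g h) (formula_ren g' h)
  | Ex _ g => fun k' h => Ex (formula_ren g (lift_ren h))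
  end.

Lemma eval_ren (M : lmodType R^c) k k' (h : 'I_k -> 'I_k') (t : term R k)
    (e : 'I_k' -> M) :
  eval e (term_ren h t) = eval (e \o h) t.
Proof. by elim: t => [i||t IHt u IHu|t IHt|t IHt r] //=; congruence. Qed.

Lemma holds_ren (M : lmodType R^c) k (f : formula R k) k' (h : 'I_k -> 'I_k')
    (e : 'I_k' -> M) :
  holds (formula_ren f h) e <-> holds f (e \o h).
Proof.
elim: f k' h e => {k} [k t u|k f IHf|k f IHf g IHg|k f IHf] k' h e /=.
- by rewrite !eval_ren.
- by rewrite IHf.
- by rewrite IHf IHg.
- have E a : env_cons a e \o lift_ren h = env_cons a (e \o h).
    apply: funext => i; rewrite /lift_ren /env_cons /=.
    by case: (unlift ord0 i) => [j|]; rewrite ?liftK ?unlift_none.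
  by split=> -[a]; [rewrite IHf E | rewrite -E -IHf]; exists a.
Qed.

(** The formula [g] is chosen before the module, as transfer between modules requires. *)
Lemma formula_exists m k (f : formula R (m + k)) :
  exists g : formula R k, forall (M : lmodType R^c) (e : 'I_k -> M),
    holds g e <-> exists y : 'I_m -> M, holds f (env_cat y e).
Proof.
elim: m f => [|m IHm] f.
  exists f => M e.
  have E (y : 'I_0 -> M) : env_cat y e = e.
    apply: funext => i; rewrite /env_cat; case: splitP => [[]//|j ij].
    by congr e; apply: val_inj.
  split=> [fe|[y]]; last by rewrite E.
  by exists (fun=> 0); rewrite E.
have [g gE] := IHm (Ex (f : formula R (m + k).+1)).
exists g => M e; rewrite gE; split=> [[y [a fa]]|[y fy]].
  by exists (env_cons a y); rewrite env_cat_cons.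
exists (y \o lift ord0), (y ord0).
by rewrite -env_cat_cons env_cons_eta.
Qed.

End Renaming.

Section FirstOrder.
Variable R : pzRingType.

(** Parameter-free definability, uniform over all modules: a single formula works in every [M]. *)
Definition fo (V : finType) (P : forall M : lmodType R^c, (V -> M) -> Prop) :=
  exists f : formula R #|V|, forall (M : lmodType R^c) (e : V -> M),
    holds f (fun i : 'I_#|V| => e (enum_val i)) <-> P M e.

Definition fo_term (V : finType) (u : forall M : lmodType R^c, (V -> M) -> M) :=
  exists t : term R #|V|, forall (M : lmodType R^c) (e : V -> M),
    eval (fun i : 'I_#|V| => e (enum_val i)) t = u M e.

Lemma fo_term_var (V : finType) (v : V) : fo_term (fun M e => e v).
Proof. by exists (Var R (enum_rank v)) => M e /=; rewrite enum_rankK. Qed.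

Lemma fo_termD (V : finType) (u w : forall M : lmodType R^c, (V -> M) -> M) :
  fo_term u -> fo_term w -> fo_term (fun M e => u M e + w M e).
Proof.
by move=> [t tE] [t' t'E]; exists (Add t t') => M e /=; rewrite tE t'E.
Qed.

Lemma fo_term_rscale (V : finType) (u : forall M : lmodType R^c, (V -> M) -> M)
    (r : R) : fo_term u -> fo_term (fun M e => rscale (u M e) r).
Proof. by move=> [t tE]; exists (Act t r) => M e /=; rewrite tE. Qed.

Lemma fo_term_sum (V I : finType)
    (u : I -> forall M : lmodType R^c, (V -> M) -> M) :
  (forall i, fo_term (u i)) -> fo_term (fun M e => \sum_i u i M e).
Proof.
move=> fu; elim: (index_enum I) => [|i s [t tE]].
  by exists (Zero R _) => M e; rewrite big_nil.
have [t' t'E] := fu i.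
by exists (Add t' t) => M e /=; rewrite big_cons tE t'E.
Qed.

Lemma fo_eq0 (V : finType) (u : forall M : lmodType R^c, (V -> M) -> M) :
  fo_term u -> fo (fun M e => u M e = 0).
Proof. by move=> [t tE]; exists (Eq t (Zero R _)) => M e /=; rewrite tE. Qed.

Lemma fo_not (V : finType) (P : forall M : lmodType R^c, (V -> M) -> Prop) :
  fo P -> fo (fun M e => ~ P M e).
Proof. by move=> [f fE]; exists (Not f) => M e /=; rewrite fE. Qed.

Lemma fo_iff (V : finType) (P Q : forall M : lmodType R^c, (V -> M) -> Prop) :
  (forall M e, P M e <-> Q M e) -> fo P -> fo Q.
Proof. by move=> PQ [f fE]; exists f => M e; rewrite fE PQ. Qed.

Lemma fo_imply (V : finType) (P Q : forall M : lmodType R^c, (V -> M) -> Prop) :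
  fo P -> fo Q -> fo (fun M e => P M e -> Q M e).
Proof.
move=> [f fE] [g gE]; exists (Not (And f (Not g))) => M e /=; rewrite fE gE.
by split=> [PQ Pe|PQ [/PQ]//]; apply: contrapT => Qe; exact: PQ.
Qed.

Lemma fo_all_fin (V I : finType)
    (P : I -> forall M : lmodType R^c, (V -> M) -> Prop) :
  (forall i, fo (P i)) -> fo (fun M e => forall i, P i M e).
Proof.
move=> fP; suff [f fE] : fo (fun M e => forall i, i \in enum I -> P i M e).
  exists f => M e; rewrite fE; split=> Pe i //.
  by apply: Pe; rewrite mem_enum.
elim: (enum I) => [|i s [f fE]]; first by exists (Eq (Zero R _) (Zero R _)).
have [g gE] := fP i; exists (And g f) => M e /=; rewrite fE gE.
split=> [[Pi Ps] j|Pis]; first by rewrite inE => /orP[/eqP->|/Ps].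
by split=> [|j js]; apply: Pis; rewrite inE ?eqxx ?js ?orbT.
Qed.

Lemma fo_ex_fin (V I : finType)
    (P : I -> forall M : lmodType R^c, (V -> M) -> Prop) :
  (forall i, fo (P i)) -> fo (fun M e => exists i, P i M e).
Proof.
move=> fP.
apply: (fo_iff (P := fun M e => ~ forall i, ~ P i M e)).
  by move=> M e; rewrite not_existsP.
by apply: fo_not; apply: fo_all_fin => i; apply: fo_not.
Qed.

Lemma fo_comp (V W : finType) (h : V -> W)
    (P : forall M : lmodType R^c, (V -> M) -> Prop) :
  fo P -> fo (fun M (e : W -> M) => P M (e \o h)).
Proof.
move=> [f fE].
exists (formula_ren f (fun i : 'I_#|V| => enum_rank (h (enum_val i)))) => M e.
rewrite holds_ren -fE.
rewrite (_ : _ \o _ = fun i : 'I_#|V| => (e \o h) (enum_val i)) //.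
by apply: funext => i /=; rewrite enum_rankK.
Qed.

Lemma fo_exists (V W : finType)
    (P : forall M : lmodType R^c, (V + W -> M) -> Prop) :
  fo P -> fo (fun M (e : V -> M) => exists y : W -> M, P M (sumf e y)).
Proof.
move=> [f fE].
(* [env_cat] puts the quantified variables first, so the enumeration of [V + W] is rearranged. *)
pose h (i : 'I_#|{: V + W}|) : 'I_(#|W| + #|V|) :=
  match enum_val i with
  | inl v => rshift #|W| (enum_rank v)
  | inr w => lshift #|V| (enum_rank w)
  end.
have [g gE] := formula_exists (formula_ren f h); exists g => M e.
have E (y : 'I_#|W| -> M) :
    env_cat y (fun i : 'I_#|V| => e (enum_val i)) \o h =
    (fun i : 'I_#|{: V + W}| => sumf e (y \o enum_rank) (enum_val i)).
  apply: funext => i; rewrite /h /env_cat /=.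
  case: (enum_val i) => [v|w] /=.
    by rewrite -[rshift _ _]/(unsplit (inr _)) unsplitK enum_rankK.
  by rewrite -[lshift _ _]/(unsplit (inl _)) unsplitK.
rewrite gE; split=> -[y].
  by rewrite holds_ren E fE; exists (y \o enum_rank).
move=> Py; exists (fun i : 'I_#|W| => y (enum_val i)).
rewrite holds_ren E fE; congr P: Py; congr sumf.
by apply: funext => w /=; rewrite enum_rankK.
Qed.

Lemma fo_forall (V W : finType)
    (P : forall M : lmodType R^c, (V + W -> M) -> Prop) :
  fo P -> fo (fun M (e : V -> M) => forall y : W -> M, P M (sumf e y)).
Proof.
move=> /fo_not/fo_exists/fo_not; apply: fo_iff => M e.
split=> [nP y|Pe [y]]; last by apply.
by apply: contrapT => Py; apply: nP; exists y.
Qed.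

Lemma fo_elem_equiv (V : finType) (V0 : V -> False)
    (P : forall M : lmodType R^c, (V -> M) -> Prop) (M N : lmodType R^c) :
  elem_equiv M N -> fo P -> P N (fun=> 0) -> P M (fun=> 0).
Proof.
move=> MN [f fE] PN.
(* [#|V|] is zero but not by computation, so the variables are renamed into ['I_0] to reach a
   sentence covered by [elem_equiv]. *)
have h (i : 'I_#|V|) : 'I_0 by case: (V0 (enum_val i)).
have E (K : lmodType R^c) : (fun=> 0) \o h = (fun i : 'I_#|V| => 0 : K) by [].
apply/(fE M (fun=> 0)); move/(fE N (fun=> 0)): PN.
rewrite -(E M) -(E N) => fN.
by apply/(holds_ren f h)/(MN (formula_ren f h))/(holds_ren f h).
Qed.

End FirstOrder.

(** * Irreducibility of pp-sets *)

(** A linear system without its constants: these become variables, over which a sentence can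
    quantify. *)
Record pp_scheme (R : Type) (n : nat) := PPScheme {
  pp_exn : nat;
  pp_eqn : nat;
  pp_coef : 'I_n -> 'I_pp_eqn -> R;
  pp_excoef : 'I_pp_exn -> 'I_pp_eqn -> R }.

Section Schemes.
Variables (R : pzRingType) (n : nat).
Implicit Type d : pp_scheme R n.

Definition pp_sol (M : lmodType R^c) d (c : 'I_(pp_eqn d) -> M) :
    set ('I_n -> M) :=
  [set x | exists y : 'I_(pp_exn d) -> M, forall i : 'I_(pp_eqn d),
    \sum_(j < n) rscale (x j) (pp_coef j i) +
    \sum_(k < pp_exn d) rscale (y k) (pp_excoef k i) + c i = 0].

Lemma pp_set_sol (M : lmodType R^c) (A : set ('I_n -> M)) : pp_set A ->
  exists dc : {d : pp_scheme R n & 'I_(pp_eqn d) -> M},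
    A = pp_sol (projT2 dc).
Proof.
by move=> [m [t [r [s [c ->]]]]]; exists (existT _ (PPScheme r s) c).
Qed.

(** Witnesses combine along with solutions: the pairs (c, x) solving a fixed scheme form a subgroup,
    as this and the next two lemmas record. *)
Lemma pp_solB (M : lmodType R^c) d (c c' : 'I_(pp_eqn d) -> M) x x' :
  pp_sol c x -> pp_sol c' x' ->
  pp_sol (fun i => c i - c' i) (fun j => x j - x' j).
Proof.
move=> [y yP] [y' y'P]; exists (fun k => y k - y' k) => i.
rewrite -[RHS](subrr 0) -[X in _ = X - _](yP i) -[X in _ = _ - X](y'P i).
rewrite !(eq_bigr _ (fun j _ => rscaleBl _ _ _)) !sumrB !opprD.
by rewrite [X in X + _ = _]addrACA [RHS]addrACA.
Qed.

Lemma pp_solD (M : lmodType R^c) d (c c' : 'I_(pp_eqn d) -> M) x x' :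
  pp_sol c x -> pp_sol c' x' ->
  pp_sol (fun i => c i + c' i) (fun j => x j + x' j).
Proof.
move=> [y yP] [y' y'P]; exists (fun k => y k + y' k) => i.
rewrite -[RHS](addr0 0) -[X in _ = X + _](yP i) -[X in _ = _ + X](y'P i).
rewrite !(eq_bigr _ (fun j _ => rscaleDl _ _ _)) !big_split /=.
by rewrite [X in X + _ = _]addrACA [RHS]addrACA.
Qed.

Lemma pp_sol0 (M : lmodType R^c) d :
  pp_sol (fun _ : 'I_(pp_eqn d) => 0 : M) (fun=> 0).
Proof.
by exists (fun=> 0) => i; rewrite !big1 ?addr0 // => *; rewrite rscale0l.
Qed.

(** Homomorphisms carry witnesses to witnesses; this is applied to the row maps of the copower. *)
Lemma pp_sol_map (M N : lmodType R^c) (h : M -> N) d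
    (c : 'I_(pp_eqn d) -> M) x :
  {morph h : a b / a + b} -> (forall r, {morph h : a / rscale a r}) ->
  pp_sol c x -> pp_sol (h \o c) (h \o x).
Proof.
move=> hD hZ [y yP]; exists (h \o y) => i.
have h0 : h 0 = 0 by rewrite -(rscale0r 0) hZ rscale0r.
rewrite -[RHS]h0 -[in RHS](yP i) !hD !(big_morph h hD h0).
by do 2![congr (_ + _)]; apply: eq_bigr => j _; rewrite hZ.
Qed.

Lemma fo_pp_sol d :
  fo (fun (M : lmodType R^c) (e : 'I_(pp_eqn d) + 'I_n -> M) =>
        pp_sol (e \o inl) (e \o inr)).
Proof.
apply: (fo_exists (P := fun (M : lmodType R^c)
    (z : ('I_(pp_eqn d) + 'I_n) + 'I_(pp_exn d) -> M) =>
  forall i, \sum_(j < n) rscale (z (inl (inr j))) (pp_coef j i) +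
    \sum_(k < pp_exn d) rscale (z (inr k)) (pp_excoef k i) +
    z (inl (inl i)) = 0)).
apply: fo_all_fin => i; apply: fo_eq0.
apply: fo_termD; last exact: fo_term_var.
by apply: fo_termD; apply: fo_term_sum => j; apply: fo_term_rscale;
  exact: fo_term_var.
Qed.

Lemma fo_pp_sol_comp (V : finType) d (h : 'I_(pp_eqn d) -> V) :
  fo (fun (M : lmodType R^c) (e : V + 'I_n -> M) =>
        pp_sol (e \o inl \o h) (e \o inr)).
Proof.
pose h' (v : 'I_(pp_eqn d) + 'I_n) : V + 'I_n :=
  match v with inl i => inl (h i) | inr j => inr j end.
exact: (fo_comp h' (fo_pp_sol d)).
Qed.

End Schemes.

(** * Rows of the countable copower *)

Section CopowerRows.
Variables (R : pzRingType) (M : lmodType R^c).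
Implicit Types (x y : copower M) (i j m : nat).

Lemma copower_valD x y m :
  copower_val (x + y) m = copower_val x m + copower_val y m.
Proof. by []. Qed.

Lemma copower_val_rscale x (r : R) m :
  copower_val (rscale x r) m = rscale (copower_val x m) r.
Proof. by []. Qed.

Lemma copower_eq x y : copower_val x =1 copower_val y -> x = y.
Proof. by move=> xy; apply: val_inj; exact: funext. Qed.

Lemma copower_fin x : finite_set [set m | copower_val x m != 0].
Proof. by case: x => u /=; rewrite unfold_in => /asboolP. Qed.

(* Splitting the index set nat as nat * nat turns a sequence into an infinite
   matrix; only finitely many of its rows are nonzero. *)
Definition row_embed_val i (u : nat -> M) (m : nat) : M :=
  if @pickle_inv (nat * nat)%type m is Some (i', j) then
    if i' == i then u j else 0
  else 0.

Lemma row_embed_subproof i x :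
  row_embed_val i (copower_val x) \in @fin_supp _ M.
Proof.
rewrite unfold_in; apply/asboolP.
apply: (sub_finite_set _
  (finite_image (fun j => pickle (i, j)) (copower_fin x))) => m /=.
rewrite /row_embed_val.
case E: (@pickle_inv (nat * nat)%type m) => [[i' j]|]; last by rewrite eqxx.
case: (i' =P i) => [ii'|_]; last by rewrite eqxx.
move=> xj; exists j => //; rewrite -ii'.
by have := pickle_invK (T := (nat * nat)%type) m; rewrite E.
Qed.

Definition row_embed i x : copower M := Copower (row_embed_subproof i x).

Lemma row_proj_subproof i x :
  (fun j => copower_val x (pickle (i, j))) \in @fin_supp _ M.
Proof.
rewrite unfold_in; apply/asboolP.
apply: (sub_finite_set _ (finite_image
  (fun m => if @pickle_inv (nat * nat)%type m is Some (_, j) then j else 0%N)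
  (copower_fin x))) => j /= xj.
by exists (pickle (i, j)) => //; rewrite pickleK_inv.
Qed.

Definition row_proj i x : copower M := Copower (row_proj_subproof i x).

Lemma row_embedD i : {morph row_embed i : x y / x + y}.
Proof.
move=> x y; apply: copower_eq => m; rewrite copower_valD /= /row_embed_val.
case: (@pickle_inv (nat * nat)%type m) => [[i' j]|]; rewrite ?addr0 //.
by case: ifP; rewrite ?addr0.
Qed.

Lemma row_embed_rscale i (r : R) : {morph row_embed i : x / rscale x r}.
Proof.
move=> x; apply: copower_eq => m.
rewrite copower_val_rscale /= /row_embed_val.
case: (@pickle_inv (nat * nat)%type m) => [[i' j]|]; rewrite ?rscale0l //.
by case: ifP; rewrite ?rscale0l.
Qed.

Lemma row_projD i : {morph row_proj i : x y / x + y}.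
Proof. by move=> x y; apply: copower_eq. Qed.

Lemma row_proj_rscale i (r : R) : {morph row_proj i : x / rscale x r}.
Proof. by move=> x; apply: copower_eq. Qed.

Lemma row_proj0 i : row_proj i 0 = 0.
Proof. exact: copower_eq. Qed.

Lemma row_projK i i' x : row_proj i (row_embed i' x) = if i == i' then x else 0.
Proof.
apply: copower_eq => j; rewrite /= /row_embed_val pickleK_inv.
by case: ifP.
Qed.

(** Elements of finite support occupy finitely many rows, so fresh rows are always available. *)
Lemma row_proj_eventually0 (J : finType) (z : J -> copower M) :
  exists m0, forall i (j : J), (m0 <= i)%N -> row_proj i (z j) = 0.
Proof.
have /choice[m mP] (j : J) :
    exists m0, forall i, (m0 <= i)%N -> row_proj i (z j) = 0.
  have /finite_seqP[s sE] := finite_image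
    (fun m => if @pickle_inv (nat * nat)%type m is Some (i, _) then i else 0%N)
    (copower_fin (z j)).
  exists (\max_(i <- s) i).+1 => i mi; apply: copower_eq => j' /=.
  apply: contrapT => /eqP zj.
  have : [set` s] i.
    by rewrite -sE; exists (pickle (i, j')) => //; rewrite pickleK_inv.
  move=> /= si; have := leq_bigmax_seq (P := xpredT) (F := id) i si isT.
  by rewrite leqNgt mi.
exists (\max_j m j) => i j mi; apply: mP.
by apply: leq_trans mi; exact: leq_bigmax.
Qed.

End CopowerRows.

Section Irreducibility.
Variables (R : pzRingType) (n : nat) (I : finType).
Variables (A : pp_scheme R n) (B : I -> pp_scheme R n).

(* If a_i in A is not in B_i for every i, perturb a point of A by a_i - b_i
   placed in a fresh row of the copower, one row for each i. *)
Lemma copower_pp_irreducible (M : lmodType R^c)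
    (c : 'I_(pp_eqn A) -> copower M)
    (c' : forall i, 'I_(pp_eqn (B i)) -> copower M) x0 :
  pp_sol c x0 ->
  (forall x, pp_sol c x -> exists i, pp_sol (c' i) x) ->
  exists i, forall x, pp_sol c x -> pp_sol (c' i) x.
Proof.
move=> Ax0 AB; apply: contrapT => nAB.
have /choice[a aP] i : exists a, pp_sol c a /\ ~ pp_sol (c' i) a.
  apply: contrapT => na; apply: nAB; exists i => x Ax.
  by apply: contrapT => Bx; apply: na; exists x.
have /choice[b bP] i : exists b, pp_sol c b /\
    forall x, pp_sol c x -> pp_sol (c' i) x -> pp_sol (c' i) b.
  have [[b [Ab Bb]]|nb] := pselect (exists b, pp_sol c b /\ pp_sol (c' i) b).
    by exists b.
  (* When A misses B_i, any point of A serves, the condition on [b] being vacuous. *)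
  by exists x0; split=> // x Ax Bx; case: nb; exists x.
have [m0 m0x] := row_proj_eventually0 x0.
have [m1 m1c] := row_proj_eventually0
  (fun p : {i : I & 'I_(pp_eqn (B i))} => c' (tag p) (tagged p)).
(* Distinct rows in which [x0] and all constants of the B_i vanish. *)
pose f (i : I) := (maxn m0 m1 + enum_rank i)%N.
have f_inj i i' : (f i == f i') = (i == i').
  apply/eqP/eqP => [|->//]; rewrite /f => /addnI /val_inj.
  exact: enum_rank_inj.
pose x j := x0 j + \sum_i row_embed (f i) (a i j - b i j).
(* A difference of two points of A solves the homogeneous system, so adding it keeps [x] in A. *)
have row_embed_pp i :
    pp_sol (fun _ : 'I_(pp_eqn A) => 0)
      (fun j => row_embed (f i) (a i j - b i j)).
  have := pp_solB (aP i).1 (bP i).1.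
  move=> /(pp_sol_map (row_embedD (f i)) (row_embed_rscale (f i))).
  congr pp_sol; apply: funext => k /=; rewrite subrr.
  by apply: (addrI (row_embed (f i) 0)); rewrite -row_embedD !addr0.
have Ax : pp_sol c x.
  have : pp_sol (fun _ : 'I_(pp_eqn A) => 0)
      (fun j => \sum_i row_embed (f i) (a i j - b i j)).
    elim: (index_enum I) => [|i s IHs].
      have := pp_sol0 (copower M) A.
      by congr pp_sol; apply: funext => j; rewrite big_nil.
    have := pp_solD (row_embed_pp i) IHs.
    by congr pp_sol; apply: funext => k; rewrite ?addr0 ?big_cons.
  move=> /(pp_solD Ax0); congr pp_sol.
  by apply: funext => k; rewrite addr0.
have [i Bx] := AB x Ax.
apply: (aP i).2.
(* Row [f i] of [x] is a_i - b_i and the constants vanish there, so this difference solves the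
   homogeneous system of B_i; adding b_i, which lies in B_i because [x] does, puts a_i in B_i. *)
have := pp_sol_map (row_projD (f i)) (row_proj_rscale (f i)) Bx.
move=> /pp_solD /(_ ((bP i).2 x Ax Bx)).
have fi0 : (m0 <= f i)%N by exact: leq_trans (leq_maxl m0 m1) (leq_addr _ _).
have fi1 : (m1 <= f i)%N by exact: leq_trans (leq_maxr m0 m1) (leq_addr _ _).
congr pp_sol; apply: funext => k /=.
  by rewrite (m1c _ (existT (fun i => 'I_(pp_eqn (B i))) i k) fi1) add0r.
rewrite row_projD m0x // add0r (big_morph _ (row_projD (f i)) (row_proj0 _ _)).
rewrite (bigD1 i) //= row_projK eqxx big1 ?addr0 ?subrK // => i' i'i.
by rewrite row_projK f_inj eq_sym (negbTE i'i).
Qed.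

Lemma pp_irreducible_sol (M : lmodType R^c)
    (c : 'I_(pp_eqn A) -> M) (c' : forall i, 'I_(pp_eqn (B i)) -> M) x0 :
  elem_equiv M (copower M) -> pp_sol c x0 ->
  (forall x, pp_sol c x -> exists i, pp_sol (c' i) x) ->
  exists i, forall x, pp_sol c x -> pp_sol (c' i) x.
Proof.
move=> MN Ax0 AB.
(* [V] collects all constants; quantifying over them universally gives a sentence, true in the
   copower and hence in [M]. *)
pose V := ('I_(pp_eqn A) + {i : I & 'I_(pp_eqn (B i))})%type.
pose hA : 'I_(pp_eqn A) -> void + V := inr \o inl.
pose hB i (k : 'I_(pp_eqn (B i))) : void + V :=
  inr (inr (existT (fun i => 'I_(pp_eqn (B i))) i k)).
have : fo (fun (N : lmodType R^c) (e : void -> N) => forall y : V -> N,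
  let e := sumf e y in
  (exists x, pp_sol (e \o hA) x) ->
  (forall x, pp_sol (e \o hA) x -> exists i, pp_sol (e \o @hB i) x) ->
  exists i, forall x, pp_sol (e \o hA) x -> pp_sol (e \o @hB i) x).
  apply: (fo_forall (P := fun (N : lmodType R^c) (e : void + V -> N) =>
    (exists x, pp_sol (e \o hA) x) ->
    (forall x, pp_sol (e \o hA) x -> exists i, pp_sol (e \o @hB i) x) ->
    exists i, forall x, pp_sol (e \o hA) x -> pp_sol (e \o @hB i) x)).
  apply: fo_imply; first exact: (fo_exists (fo_pp_sol_comp hA)).
  apply: fo_imply.
    apply: (fo_forall (P := fun (N : lmodType R^c) e =>
      pp_sol (e \o inl \o hA) (e \o inr) ->
      exists i, pp_sol (e \o inl \o @hB i) (e \o inr))).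
    apply: fo_imply; first exact: fo_pp_sol_comp.
    by apply: fo_ex_fin => i; exact: fo_pp_sol_comp.
  apply: fo_ex_fin => i.
  apply: (fo_forall (P := fun (N : lmodType R^c) e =>
    pp_sol (e \o inl \o hA) (e \o inr) ->
    pp_sol (e \o inl \o @hB i) (e \o inr))).
  by apply: fo_imply; exact: fo_pp_sol_comp.
move=> /(fo_elem_equiv (fun v : void => match v with end) MN) PM.
apply: (PM _ (sumf c (fun p => c' (tag p) (tagged p)))); first last.
- by move=> x /AB[i Bx]; exists i.
- by exists x0.
- by move=> y e [x Ax] ABx; exact: copower_pp_irreducible Ax ABx.
Qed.

End Irreducibility.

(** The hypothesis on the theory of [M] enters everything below in this form. *)
Definition irreducible_pp (R : pzRingType) (M : lmodType R^c) :=
  forall n (A : set ('I_n -> M)) (b : set (set ('I_n -> M))),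
    pp_set A -> A !=set0 -> finite_set b -> (forall B, b B -> pp_set B) ->
    A `<=` union b -> exists2 B, b B & A `<=` B.

Lemma pp_irreducible (R : pzRingType) (M : lmodType R^c) :
  elem_equiv M (copower M) -> irreducible_pp M.
Proof.
move=> MN n A b /pp_set_sol[[d c] /= ->] [x0 Ax0] /finite_seqP[s ->] bpp Ab.
have /choice[dc dcE] (i : 'I_(size s)) :
    exists dc : {d : pp_scheme R n & 'I_(pp_eqn d) -> M},
      tnth (in_tuple s) i = pp_sol (projT2 dc).
  by apply: pp_set_sol; apply: bpp; exact: mem_tnth.
have [|i AB] := @pp_irreducible_sol _ _ _ d (fun i => projT1 (dc i)) M c
    (fun i => projT2 (dc i)) x0 MN Ax0.
  move=> x /Ab[B /(tnthP (in_tuple s))[i ->]]; rewrite dcE; by exists i.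
by exists (tnth (in_tuple s) i); [exact: mem_tnth | rewrite dcE].
Qed.

(** * Quantifier elimination *)

Section Definable.
Variables (R : pzRingType) (M : lmodType R^c).

(* Boolean combinations of pp-sets: membership depends only on membership in
   finitely many pp-sets. *)
Definition pp_boolean n (D : set ('I_n -> M)) : Prop :=
  exists (I : finType) (A : I -> set ('I_n -> M)),
    (forall i, pp_set (A i)) /\
    forall x y, (forall i, A i x <-> A i y) -> D x -> D y.

Lemma pp_boolean_pp n (A : set ('I_n -> M)) : pp_set A -> pp_boolean A.
Proof.
by move=> Ap; exists unit, (fun=> A); split=> // x y /(_ tt) xy /xy.
Qed.

Lemma pp_booleanC n (D : set ('I_n -> M)) : pp_boolean D -> pp_boolean (~` D).
Proof.
move=> [I [A [Ap AD]]]; exists I, A; split=> // x y xy Dx Dy.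
by apply: Dx; apply: AD Dy => i; rewrite xy.
Qed.

Lemma pp_booleanI n (D E : set ('I_n -> M)) :
  pp_boolean D -> pp_boolean E -> pp_boolean (D `&` E).
Proof.
move=> [I [A [Ap AD]]] [J [B [Bp BE]]]; exists (I + J)%type, (sumf A B).
split=> [[i|j]|x y xy [Dx Ex]] //=; split.
  by apply: AD Dx => i; exact: (xy (inl i)).
by apply: BE Ex => j; exact: (xy (inr j)).
Qed.

Lemma pp_boolean_preimage n k (D : set ('I_k -> M))
    (g : ('I_n -> M) -> 'I_k -> M) :
  (forall j, affine (g^~ j)) -> pp_boolean D -> pp_boolean (g @^-1` D).
Proof.
move=> ag [I [A [Ap AD]]]; exists I, (fun i => g @^-1` A i).
by split=> [i|x y xy /=]; [exact: pp_preimage | exact: AD].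
Qed.

(* Over x, the fibre of an intersection P of some of the A i meets the
   complement of all the others iff it is not contained in any of them, by
   irreducibility. As P and A i are cosets, whether a fibre of P on which A i
   is nonempty lies in A i does not depend on the fibre. *)
Lemma pp_boolean_proj n (D : set ('I_n.+1 -> M)) : irreducible_pp M ->
  pp_boolean D -> pp_boolean [set x | exists a, D (env_cons a x)].
Proof.
move=> irr [I [A [Ap AD]]].
pose P (S : {set I}) := [set z | forall i, i \in S -> A i z].
have Pp S : pp_set (P S) by exact: pp_bigcap.
(* Over [x] these record whether the fibre of [P S] is nonempty, and whether it meets [A i]. *)
pose B (p : {set I} * option I) := [set x | exists a,
  (if p.2 is Some i then P p.1 `&` A i else P p.1) (env_cons a x)].
exists ({set I} * option I)%type, B; split.
  by move=> [S [i|]]; apply: pp_proj => //; exact: pp_setI.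
move=> x x' xx' [a Dxa].
pose S := [set i | `[<A i (env_cons a x)>]]%SET.
have PSa : P S (env_cons a x) by move=> i; rewrite inE => /asboolP.
pose g (y : 'I_1 -> M) := env_cons (y ord0) x'.
have ag j : affine (g^~ j).
  rewrite /g /env_cons; case: (unlift ord0 j) => [j'|]; last exact: affine_var.
  exact: affine_cst.
have [a' PSa'] : B (S, None) x' by apply/xx'; exists a.
(* The traces on the fibre over [x'] of those [A i] that miss (a, x). A point of [P S] outside all
   of them lies in the same [A i] as (a, x), hence in [D]. *)
pose b := (fun i => g @^-1` A i) @` [set i | i \notin S].
apply: contrapT => nD.
have [|||B0 [i /= iS <-] PSA] := irr _ (g @^-1` P S) b
    (pp_preimage ag (Pp S)) _ (finite_image _ finite_finset).
- by exists (fun=> a').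
- by move=> _ [i _ <-]; exact: pp_preimage.
- move=> y /= PSy; apply: contrapT => yb; apply: nD; exists (y ord0).
  apply: AD Dxa => i; split=> [Aix|Aiy].
    by apply: PSy; rewrite inE; apply/asboolP.
  have [iS|iS] := boolP (i \in S).
    by move: iS; rewrite inE => /asboolP.
  by case: yb; exists (g @^-1` A i) => //; exists i.
have [a1 [PSa1 Aia1]] : B (S, Some i) x.
  apply/xx'; exists a'; split=> //.
  by apply: (PSA (fun=> a')).
move: iS; rewrite inE => /asboolP; apply.
(* Translating (a, x) by (a', x') - (a1, x) lands in the fibre over [x'], so in [A i]; translating
   back puts (a, x) in [A i], a contradiction. *)
have PSu : P S (env_cons (a - a1 + a') x').
  move: (pp_heap (Pp S) PSa PSa1 PSa'); congr P; apply: funext => j.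
  rewrite /env_cons; case: (unlift ord0 j) => // j'.
  by rewrite subrr add0r.
have := PSA (fun=> a - a1 + a') PSu => /= Au.
move: (pp_heap (Ap i) Au (PSA (fun=> a') PSa') Aia1).
congr (A i); apply: funext => j; rewrite /= /g /env_cons.
case: (unlift ord0 j) => [j'|]; first by rewrite subrr add0r.
by rewrite addrK subrK.
Qed.

Lemma pp_boolean_holds k (f : formula R k) : irreducible_pp M ->
  pp_boolean [set e : 'I_k -> M | holds f e].
Proof.
move=> irr; elim: f => {k} [k t u|k f IHf|k f IHf g IHg|k f IHf] /=.
- have := pp_affine_eq (affineD (affine_eval M t) (affineN (affine_eval M u))).
  move=> /pp_boolean_pp; congr pp_boolean.
  by apply/seteqP; split=> e /= => [/subr0_eq|->]; rewrite ?subrr.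
- exact: pp_booleanC.
- exact: pp_booleanI.
- exact: pp_boolean_proj.
Qed.

(** Parameters are substituted by an affine map, so elimination for parameter-free formulas
    suffices. *)
Lemma definable_pp_boolean n (D : set ('I_n -> M)) : irreducible_pp M ->
  definable D -> pp_boolean D.
Proof.
move=> irr [p [f [c ->]]].
apply: (pp_boolean_preimage (g := fun x => env_cat x c)); last first.
  exact: pp_boolean_holds.
move=> j; rewrite /env_cat; case: (fintype.split j) => [i|i].
  exact: affine_var.
exact: affine_cst.
Qed.

(** * Boolean closure of the definable sets *)

Lemma definableC n (D : set ('I_n -> M)) : definable D -> definable (~` D).
Proof. by move=> [p [f [c ->]]]; exists p, (Not f), c. Qed.

Lemma definableI n (D E : set ('I_n -> M)) :
  definable D -> definable E -> definable (D `&` E).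
Proof.
move=> [p [f [c ->]]] [q [g [d ->]]].
pose hp : 'I_(n + p) -> 'I_(n + (p + q)) := fun i =>
  match fintype.split i with
  | inl j => lshift _ j | inr j => rshift n (lshift q j) end.
pose hq : 'I_(n + q) -> 'I_(n + (p + q)) := fun i =>
  match fintype.split i with
  | inl j => lshift _ j | inr j => rshift n (rshift p j) end.
have Ep x : env_cat x (env_cat c d) \o hp = env_cat x c.
  apply: funext => i; rewrite /hp /env_cat /=.
  case: (fintype.split i) => j.
    by rewrite -[lshift _ _]/(unsplit (inl _)) unsplitK.
  rewrite -[rshift _ _]/(unsplit (inr _)) unsplitK.
  by rewrite -[lshift _ _]/(unsplit (inl _)) unsplitK.
have Eq x : env_cat x (env_cat c d) \o hq = env_cat x d.
  apply: funext => i; rewrite /hq /env_cat /=.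
  case: (fintype.split i) => j.
    by rewrite -[lshift _ _]/(unsplit (inl _)) unsplitK.
  by rewrite -![rshift _ _]/(unsplit (inr _)) !unsplitK.
exists (p + q)%N, (And (formula_ren f hp) (formula_ren g hq)), (env_cat c d).
by apply/seteqP; split=> x /=; rewrite !holds_ren Ep Eq.
Qed.

Lemma definableD n (D E : set ('I_n -> M)) :
  definable D -> definable E -> definable (D `\` E).
Proof. by move=> Dd /definableC; rewrite setDE; exact: definableI. Qed.

Lemma definable_set0 n : definable (set0 : set ('I_n -> M)).
Proof.
exists 0%N, (Not (Eq (Zero R _) (Zero R _))), (fun=> 0).
by apply/seteqP; split=> x //= [].
Qed.

Lemma definable_union n (a : set (set ('I_n -> M))) :
  finite_set a -> (forall A, a A -> definable A) -> definable (union a).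
Proof.
move=> /finite_seqP[s ->]; elim: s => [|A s IHs] sd.
  rewrite (_ : union _ = set0); first exact: definable_set0.
  by apply/seteqP; split=> x //= -[].
rewrite (_ : union _ = ~` (~` A `&` ~` union [set` s])).
  apply/definableC/definableI; apply: definableC.
    by apply: sd; exact: mem_head.
  by apply: IHs => B Bs; apply: sd; rewrite /= inE Bs orbT.
apply/seteqP; split=> x /=.
  move=> [B /=]; rewrite inE => /orP[/eqP-> Ax [] //|Bs Bx [_]].
  by apply; exists B.
move=> nx; apply: contrapT => xU; apply: nx; split=> [Ax|[B Bs Bx]]; apply: xU.
  by exists A => //; exact: mem_head.
by exists B => //=; rewrite inE Bs orbT.
Qed.

Lemma definable_pp n (A : set ('I_n -> M)) : pp_set A -> definable A.
Proof.
move=> /pp_set_sol[[d c] /= ->].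
have [f fE] := fo_pp_sol d.
pose h (i : 'I_#|{: 'I_(pp_eqn d) + 'I_n}|) : 'I_(n + pp_eqn d) :=
  match enum_val i with inl i => rshift n i | inr j => lshift _ j end.
exists (pp_eqn d), (formula_ren f h), c.
apply/seteqP; suff E x : holds (formula_ren f h) (env_cat x c) <-> pp_sol c x.
  by split=> x /E.
rewrite holds_ren (_ : _ \o h = fun i : 'I_#|_| => sumf c x (enum_val i)).
  exact: (fE M (sumf c x)).
apply: funext => i; rewrite /h /env_cat /=.
case: (enum_val i) => j /=.
  by rewrite -[rshift _ _]/(unsplit (inr _)) unsplitK.
by rewrite -[lshift _ _]/(unsplit (inl _)) unsplitK.
Qed.

End Definable.

(** * Alternating decompositions *)

Section Chains.
Variables (R : pzRingType) (M : lmodType R^c) (n : nat).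
Implicit Types (a b : set (set ('I_n -> M))) (g : nat -> set (set ('I_n -> M))).

(* A tower C_0, C_1, ... is encoded by the sequence
   P(C_0), N(C_0), P(C_1), N(C_1), ... *)
Definition chain g : Prop :=
  [/\ forall i, antichain (g i),
      forall i, prec (g i.+1) (g i) &
      exists K, g K = set0].

(** For a chain, with F_i the union of [g i], this is the iterated difference F_0 \ (F_1 \ (F_2 \
    ...)). *)
Definition alternate g : set ('I_n -> M) :=
  [set x | exists i, union (g i.*2) x /\ ~ union (g i.*2.+1) x].

Lemma antichain0 : antichain (set0 : set (set ('I_n -> M))).
Proof. by split. Qed.

Lemma chain_shift g : chain g -> chain (g \o S).
Proof.
move=> [ga gp [K gK]]; split=> [i|i|]; [exact: ga | exact: gp |].
by exists K; apply/seteqP; split=> // B /= /gp[A]; rewrite gK.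
Qed.

Lemma prec_union b a : prec b a -> union b `<=` union a.
Proof. by move=> ba x [B /ba[A aA [BA _]] Bx]; exists A => //; exact: BA. Qed.

Lemma chain_union g i j : chain g -> (i <= j)%N -> union (g j) `<=` union (g i).
Proof.
move=> [_ gp _] /subnKC <-; elim: (j - i)%N => [|k IHk]; first by rewrite addn0.
by rewrite addnS; apply: subset_trans IHk; exact: prec_union.
Qed.

Lemma chain_eventually0 g : chain g ->
  exists K, forall i, (K <= i)%N -> g i = set0.
Proof.
move=> [_ gp [K gK]]; exists K => i /subnKC <-.
elim: (i - K)%N => [|k IHk]; first by rewrite addn0.
by rewrite addnS; apply/seteqP; split=> // B /gp[A]; rewrite IHk.
Qed.

Lemma alternate_sub g : chain g -> alternate g `<=` union (g 0%N).
Proof. by move=> gc x [i [gx _]]; exact: chain_union gx. Qed.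

(** The unions decrease, so membership depends on the parity of the first index at which a point
    drops out; the shift flips this parity. *)
Lemma alternate_shift g :
  chain g -> alternate (g \o S) = union (g 0%N) `\` alternate g.
Proof.
move=> gc; apply/seteqP; split=> x /=.
  move=> [i [/= gx ngx]]; split; first exact: chain_union gx.
  move=> [j [gjx ngjx]].
  have [ij|ji] := ltnP i j.
    by apply: ngx; apply: chain_union gjx => //; rewrite -doubleS leq_double.
  by apply: ngjx; apply: chain_union gx; rewrite // ltnS leq_double.
move=> [g0x nax].
have [K gK] := chain_eventually0 gc.
have exN : exists i, `[< ~ union (g i) x >].
  by exists K; apply/asboolP; rewrite gK // => -[].
case: (ex_minnP exN) => -[|m] /asboolP ngx mmin; first by case: ngx.
have gx : union (g m) x.
  apply: contrapT => ngmx; have := mmin m; rewrite ltnn.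
  by move/(_ (asboolT ngmx)).
have [m_odd|m_even] := boolP (odd m).
  exists m./2; have := odd_double_half m; rewrite m_odd add1n => /= ->.
  by split.
case: nax; exists m./2; rewrite even_halfK //.
Qed.

Lemma chain_cons a g : antichain a -> prec (g 0%N) a -> chain g ->
  chain (fun i => if i is j.+1 then g j else a).
Proof.
move=> aa ga [gaa gp [K gK]]; split=> [[]//|[]//|].
by exists K.+1.
Qed.

Lemma alternate_cons a g : antichain a -> prec (g 0%N) a -> chain g ->
  alternate (fun i => if i is j.+1 then g j else a) = union a `\` alternate g.
Proof.
move=> aa ga gc; have cc := chain_cons aa ga gc.
have := alternate_shift cc; rewrite -[_ \o S]/g => -> /=.
rewrite setDD; apply/esym/setIidr; exact: (alternate_sub cc).
Qed.

(** * Uniqueness of the alternating decomposition *)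

Section Uniqueness.
Hypothesis irr : irreducible_pp M.

(** No member of [b] can contain [A], since it lies strictly inside a member of the antichain [a];
    irreducibility then leaves only [c]. *)
Lemma prec_not_cover a b c A : antichain a -> antichain b -> prec b a ->
  finite_set c -> (forall B, c B -> pp_set B) ->
  a A -> A `<=` union b `|` union c -> exists2 B, c B & A `<=` B.
Proof.
move=> [_ app amax] [bf bpp _] ba cf cpp aA Abc.
have [Ap A0] := app A aA.
have [|B|x /Abc[] [B BB Bx]|B [bB|cB] AB] := irr (b := b `|` c) Ap A0.
- by rewrite finite_setU.
- by move=> [/bpp[]|/cpp].
- by exists B => //; left.
- by exists B => //; right.
- have [A' aA' [BA' A'B]] := ba B bB.
  have AA' : A = A' by apply: amax => //; exact: subset_trans BA'.
  by case: A'B; rewrite -AA'.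
- by exists B.
Qed.

(** The head lists the irreducible components of the closure of the alternating set. By [cover], A
    lies in some A' of the other head and A' in some A'' of the first; the antichain forces A = A' =
    A''. *)
Lemma alternate_head_sub g g' : chain g -> chain g' ->
  alternate g = alternate g' -> g 0%N `<=` g' 0%N.
Proof.
have cover h b : chain h -> antichain b -> alternate h `<=` union b ->
    forall A, h 0%N A -> exists2 B, b B & A `<=` B.
  move=> [ha hp _] [bf bpp _] hb A h0A.
  apply: (prec_not_cover (ha 0%N) (ha 1%N) (hp 0%N) bf _ h0A).
    by move=> B /bpp[].
  move=> x Ax.
  have [|h1x] := pselect (union (h 1%N) x); first by left.
  by right; apply: hb; exists 0%N; split=> //; exists A.
move=> gc g'c gg' A gA.
have [[ga _ _] [g'a _ _]] := (gc, g'c).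
have [|A' g'A' AA'] := cover g _ gc (g'a 0%N) _ A gA.
  by rewrite gg'; exact: alternate_sub.
have [|A'' gA'' A'A''] := cover g' _ g'c (ga 0%N) _ A' g'A'.
  by rewrite -gg'; exact: alternate_sub.
have [_ _ amax] := ga 0%N.
have AA'' : A = A'' by apply: amax => //; exact: subset_trans A'A''.
by rewrite (_ : A = A') //; apply/seteqP; rewrite {2}AA''.
Qed.

(** Once the heads agree, complementing in their union shows that the tails have the same
    alternating set. *)
Lemma alternate_inj g g' : chain g -> chain g' ->
  alternate g = alternate g' -> g =1 g'.
Proof.
move=> gc g'c gg' i; elim: i g g' gc g'c gg' => [|i IHi] g g' gc g'c gg'.
  by apply/seteqP; split; exact: alternate_head_sub.
apply: (IHi (g \o S) (g' \o S)); [exact: chain_shift | exact: chain_shift |].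
rewrite !alternate_shift // gg' (_ : g 0%N = g' 0%N) //.
by apply/seteqP; split; exact: alternate_head_sub.
Qed.

End Uniqueness.

(** * Existence of the alternating decomposition *)

Section Existence.
Variables (I : finType) (A : I -> set ('I_n -> M)).

Definition pp_type (x : 'I_n -> M) : {set I} := [set i | `[< A i x >]]%SET.

(** If [S] is the type of a point, [pp_flat S] lies in [pp_flat S'] exactly when [S'] is a subset of
    [S], so such inclusions are decided on finite index sets. *)
Definition pp_flat (S : {set I}) : set ('I_n -> M) :=
  [set x | forall i, i \in S -> A i x].

Lemma pp_flatE S x : pp_flat S x <-> (S \subset pp_type x).
Proof.
split=> [Sx|/fintype.subsetP Sx i /Sx]; last by rewrite inE => /asboolP.
by apply/fintype.subsetP => i /Sx Aix; rewrite inE; apply/asboolP.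
Qed.

Lemma pp_flat_type x : pp_flat (pp_type x) x.
Proof. exact/pp_flatE. Qed.

Lemma pp_flat_type_sub x S :
  pp_flat (pp_type x) `<=` pp_flat S -> S \subset pp_type x.
Proof. by move=> sub; apply/pp_flatE/sub/pp_flat_type. Qed.

Lemma pp_flatS (S S' : {set I}) : S \subset S' -> pp_flat S' `<=` pp_flat S.
Proof. by move=> /fintype.subsetP SS' x Sx i /SS'/Sx. Qed.

(* The complement of D_T in the union of the minimal flats is D_T' with T' the
   types above T that are not in T; the up-closure of T' is smaller. *)
Lemma alternate_of_types (T : {set {set I}}) :
  (forall i, pp_set (A i)) -> (forall S, S \in T -> exists x, pp_type x = S) ->
  exists g, [/\ chain g, alternate g = [set x | pp_type x \in T] &
    forall B, g 0%N B -> exists2 S, S \in T & B = pp_flat S].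
Proof.
move=> Ap.
pose up (T : {set {set I}}) := [set S : {set I} |
  `[< exists x, pp_type x = S >] && [exists S' in T, S' \subset S]]%SET.
have [m] := ubnP #|up T|; elim: m T => // m IHm T upT Tr.
have [->|[S0 S0T]] := set_0Vmem T.
  exists (fun=> set0); split=> [||//].
    by split=> [i|i //|]; [exact: antichain0 | exists 0%N].
  by apply/seteqP; split=> x /=; [move=> [i [[]]] | rewrite inE].
pose T' := (up T :\: T)%SET.
have T'r S : S \in T' -> exists x, pp_type x = S.
  by rewrite !inE => /and3P[_ /asboolP].
pose minT S := minset (mem T) S.
have minT_ex S : S \in T -> exists2 S', minT S' & S' \subset S.
  by move=> ST; have [S' ? ?] := minset_exists (P := mem T) ST; exists S'.
have minT_in S : minT S -> S \in T by move=> /minsetP[].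
have minT_eq S S' : minT S -> S' \in T -> S' \subset S -> S' = S.
  by move=> /minsetP[_ Smin] S'T /Smin; apply.
(* A minimal type S1 of [T] leaves the up-closure: a type of [T'] below S1 would lie above one in
   [T], so minimality would make it S1 itself, which is in [T]. *)
have upT' : (#|up T'| < #|up T|)%N.
  apply: proper_card; apply/fintype.properP; split.
    apply/fintype.subsetP => S; rewrite !inE => /andP[-> /exists_inP[S']] /=.
    rewrite !inE => /and3P[_ _ /exists_inP[S'' S''T S''S'] S'S].
    by apply/exists_inP; exists S'' => //; exact: fintype.subset_trans S'S.
  have [S1 S1min _] := minT_ex S0 S0T; exists S1.
    rewrite inE; apply/andP; split; first exact/asboolP/Tr/minT_in.
    by apply/exists_inP; exists S1; first exact: minT_in.
  rewrite inE; apply/negP => /andP[_ /exists_inP[S']].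
  rewrite !inE => /and3P[S'T _ /exists_inP[S'' S''T S''S'] S'S1].
  have S''E := minT_eq _ _ S1min S''T (fintype.subset_trans S''S' S'S1).
  have S'E : S' = S1 by apply/eqP; rewrite finset.eqEsubset S'S1 -S''E.
  by rewrite S'E minT_in in S'T.
have [|g [gc gE g0]] := IHm T' _ T'r; first exact: leq_trans upT' _.
pose a := pp_flat @` [set S | minT S].
have aa : antichain a.
  split.
  - exact: finite_image finite_finset.
  - move=> _ [S Smin <-]; split; first exact: pp_bigcap.
    by have [x <-] := Tr S (minT_in _ Smin); exists x; exact: pp_flat_type.
  - move=> _ _ [S Smin <-] [S' S'min <-] SS'.
    have [x xS] := Tr S (minT_in _ Smin); rewrite -xS in SS' Smin *.
    by rewrite (minT_eq _ _ Smin (minT_in _ S'min) (pp_flat_type_sub SS')).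
(* A type in [T'] lies above a minimal type of [T] and differs from it, being outside [T], so its
   flat is strictly smaller. The clause on [g 0] is carried through the induction for this. *)
have ga : prec (g 0%N) a.
  move=> _ /g0[S ST' ->]; have [x xS] := T'r S ST'.
  move: ST'; rewrite !inE => /and3P[ST _ /exists_inP[S' S'T S'S]].
  have [S1 S1min S1S'] := minT_ex S' S'T.
  exists (pp_flat S1); first by exists S1.
  split; first exact/pp_flatS/(fintype.subset_trans S1S').
  have [y yS1] := Tr S1 (minT_in _ S1min).
  rewrite -yS1 => /pp_flat_type_sub; rewrite yS1 => SS1.
  move: ST; rewrite (_ : S = S1) ?minT_in //.
  by apply/eqP; rewrite finset.eqEsubset SS1 (fintype.subset_trans S1S').
exists (fun i => if i is j.+1 then g j else a); split.
- exact: chain_cons.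
(* A point of the union of [a] has its type in [up T]; removing [T'] leaves the types in [T]. *)
- rewrite alternate_cons // gE; apply/seteqP; split=> x /=.
    move=> [[_ [S Smin <-] /pp_flatE Sx] /negP].
    rewrite !inE negb_and negbK => /orP[//|/negP[]].
    apply/andP; split; first by apply/asboolP; exists x.
    by apply/exists_inP; exists S => //; exact: minT_in.
  move=> xT; split; last by rewrite !inE xT.
  have [S Smin Sx] := minT_ex _ xT.
  by exists (pp_flat S); [exists S | apply/pp_flatE].
- by move=> _ [S Smin <-]; exists S => //; exact: minT_in.
Qed.

End Existence.

Lemma alternate_pp_boolean D : pp_boolean D ->
  exists2 g, chain g & alternate g = D.
Proof.
move=> [I [A [Ap AD]]].
(* [D] is the union of the type classes it meets. *)
pose T := [set S : {set I} | `[< exists2 x, pp_type A x = S & D x >]]%SET.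
have [|g [gc gE _]] := @alternate_of_types I A T Ap.
  by move=> S; rewrite inE => /asboolP[x]; exists x.
exists g => //; rewrite gE; apply/seteqP; split=> x; rewrite /= inE.
  move=> /asboolP[y xy Dy]; apply: AD Dy => i.
  by have /finset.setP/(_ i) := xy; rewrite !inE => E; split=> /asboolP;
    [rewrite E | rewrite -E] => /asboolP.
by move=> Dx; apply/asboolP; exists x.
Qed.

End Chains.

(** * Towers *)

Section Towers.
Variables (R : pzRingType) (M : lmodType R^c) (n : nat).
Implicit Types (C D : set ('I_n -> M)) (F : set (set ('I_n -> M))).
Implicit Types (g : nat -> set (set ('I_n -> M))).

(** Nonemptiness drops the differences at the tail of the chain, which would contribute the empty
    cell. *)
Definition chain_cells g : set (set ('I_n -> M)) :=
  [set C | exists i, C = union (g i.*2) `\` union (g i.*2.+1) /\ C !=set0].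

Lemma union_chain_cells g : union (chain_cells g) = alternate g.
Proof.
apply/seteqP; split=> x; first by move=> [_ [i [-> _]] xi]; exists i.
move=> [i xi]; exists (union (g i.*2) `\` union (g i.*2.+1)) => //.
by exists i; split=> //; exists x.
Qed.

Lemma cell_presents C : cell C -> presents C (cell_pres C).
Proof. exact: xgetPex. Qed.

Lemma tower_chain F : tower F -> exists2 g, chain g & F = chain_cells g.
Proof.
move=> [l [C [-> CP _ [s sP]]]].
(* Past the last cell the default is a pair of empty antichains, so the chain terminates. *)
pose G k := if insub k is Some o then cell_pres (C (s o)) else (set0, set0).
have GE (o : 'I_l) : G o = cell_pres (C (s o)) by rewrite /G valK.
have presG (o : 'I_l) : presents (C (s o)) (G o).
  by rewrite GE; apply: cell_presents; case: (CP (s o)).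
have G0 k : (l <= k)%N -> G k = (set0, set0).
  by move=> lk; rewrite /G insubF // ltnNge lk.
pose g m := if odd m then (G m./2).2 else (G m./2).1.
have gE k : g k.*2 = (G k).1 by rewrite /g odd_double doubleK.
have gO k : g k.*2.+1 = (G k).2 by rewrite /g /= odd_double uphalf_double.
exists g.
  split=> [m|m|].
  - rewrite /g; have [ml|/G0->] := ltnP m./2 l; last first.
      by case: ifP => _; exact: antichain0.
    by have [? ? _ _] := presG (Ordinal ml); case: ifP.
  (* Odd steps are the tower condition between consecutive cells, even steps the condition inside
     one cell. *)
  - rewrite -(odd_double_half m); case: (odd m); rewrite ?add0n ?add1n.
      rewrite -doubleS gE gO.
      have [ml|/G0->] := ltnP m./2.+1 l; last by move=> B.
      have ml' := ltnW ml.
      rewrite (GE (Ordinal ml)) (GE (Ordinal ml')).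
      exact: (sP (Ordinal ml') (Ordinal ml)).
    rewrite gE gO; have [ml|/G0->] := ltnP m./2 l; last by move=> B.
    by have [] := presG (Ordinal ml).
  - by exists l.*2; rewrite gE G0.
apply/seteqP; split=> [_ [j _ <-]|D [k [-> [x [kx _]]]]].
  pose o := (s^-1)%g j; exists o; have := presG o.
  rewrite permKV gE gO => -[_ _ _ CE]; split=> //.
  by case: (CP j).
have [kl|/G0 Gk] := ltnP k l; last by move: kx; rewrite gE Gk => -[].
exists (s (Ordinal kl)) => //; have [_ _ _ ->] := presG (Ordinal kl).
by rewrite gE gO.
Qed.

Section Irreducible.
Hypothesis irr : irreducible_pp M.

(** A presentation is a chain of length two whose alternating set is the cell, so uniqueness for
    chains applies. *)
Lemma presents_inj C p q : presents C p -> presents C q -> p = q.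
Proof.
pose g (p : set (set ('I_n -> M)) * set (set ('I_n -> M))) (i : nat) :=
  match i with 0%N => p.1 | 1%N => p.2 | _ => set0 end.
have gP r : presents C r -> chain (g r) /\ alternate (g r) = C.
  move=> [r1 r2 r12 ->]; split.
    split; last by exists 2%N.
      by move=> [|[|i]] //; exact: antichain0.
    by move=> [|i] //= B.
  apply/seteqP; split=> x; last by move=> ?; exists 0%N.
  by move=> [[|i] //= [[]]].
move=> /gP[cp pC] /gP[cq qC].
have E := alternate_inj irr cp cq (etrans pC (esym qC)).
by rewrite [p]surjective_pairing [q]surjective_pairing; congr pair;
  [exact: (E 0%N) | exact: (E 1%N)].
Qed.

Lemma chain_tower g : chain g -> tower (chain_cells g).
Proof.
move=> gc; have [ga gp _] := gc; have [K gK] := chain_eventually0 gc.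
(* The least such [l] is the number of cells: before it every even-indexed antichain is nonempty. *)
have ex0 : exists l, `[< g l.*2 = set0 >].
  exists K; apply/asboolP/gK; rewrite -addnn; exact: leq_addr.
case: (ex_minnP ex0) => l /asboolP gl lmin.
pose C (j : 'I_l) := union (g j.*2) `\` union (g j.*2.+1).
have C0 j : C j !=set0.
  have /eqP/set0P[A gA] : g j.*2 <> set0.
    by move=> /asboolT /lmin; rewrite leqNgt ltn_ord.
  (* Were the cell empty, a member of its upper antichain would be covered by the lower one. *)
  apply: contrapT => Cj.
  have [|x Ax|B []] := prec_not_cover irr (c := set0)
    (ga j.*2) (ga j.*2.+1) (gp _) (finite_set0 _) _ gA.
  - by [].
  - left; apply: contrapT => nx; apply: Cj; exists x; split=> //.
    by exists A.
have presC j : presents (C j) (g j.*2, g j.*2.+1).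
  by split; [exact: ga | exact: ga | exact: gp |].
(* By uniqueness the chosen presentations are these, so the tower condition becomes one on [g]. *)
have presE j : cell_pres (C j) = (g j.*2, g j.*2.+1).
  apply: presents_inj (presC j); apply: cell_presents.
  by exists (g j.*2, g j.*2.+1).
exists l, C; split.
- apply/seteqP; split=> [D [i [DE [x]]]|_ [j _ <-]]; last by exists j.
  rewrite DE => -[ix _]; have [il|li] := ltnP i l; first by exists (Ordinal il).
  have: union (g l.*2) x by apply: chain_union ix; rewrite ?leq_double.
  by rewrite gl => -[].
- by move=> j; split; [exists (g j.*2, g j.*2.+1) | exact: C0].
- have disj (i j : 'I_l) x : C i x -> C j x -> ~ (i < j)%N.
    move=> [_ nix] [jx _] ij; apply: nix; apply: chain_union jx => //.
    by rewrite ltn_double.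
  move=> i j _ _ [x [Cix Cjx]]; have [ij|ji|ij] := ltngtP i j.
  + by case: (disj i j x Cix Cjx).
  + by case: (disj j i x Cjx Cix).
  + exact: ord_inj.
- exists 1%g => i j ji; rewrite !perm1 /cell_P /cell_N !presE /= ji.
  exact: gp.
Qed.

End Irreducible.

Lemma tower_definable F : tower F -> definable (union F).
Proof.
move=> [l [C [-> CP _ _]]]; apply: definable_union.
  exact: finite_image finite_finset.
move=> _ [j _ <-]; have [[[a b] [[af app _] [bf bpp _] _ ->]] _] := CP j.
apply: definableD; apply: definable_union => // A.
  by move=> /app[/definable_pp].
by move=> /bpp[/definable_pp].
Qed.

End Towers.

Theorem theorem6p3p6 (R : pzRingType) (M : lmodType R^c) (n : nat)
    (n_ge1 : (1 <= n)%N)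
    (M_aleph0 : elem_equiv M (copower M)) :
  exists f : set (set ('I_n -> M)) -> set ('I_n -> M),
    set_bij [set F | tower F] [set D | definable D] f /\
    forall F, tower F -> f F = \bigcup_(C in F) C.
Proof.
have irr := pp_irreducible M_aleph0.
exists (@union R M n); split=> //; split.
- exact: tower_definable.
(* Both towers come from chains whose alternating sets are the unions; equal unions force equal
   chains, hence equal towers. *)
- move=> F F' /set_mem/tower_chain[g gc ->] /set_mem/tower_chain[g' g'c ->].
  rewrite !union_chain_cells => /(alternate_inj irr gc g'c) gg'.
  by rewrite (funext gg').
- move=> D /(definable_pp_boolean irr)/alternate_pp_boolean[g gc <-].
  by exists (chain_cells g); [exact: chain_tower | exact: union_chain_cells].
Qed.
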